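(* Let $T\ge1$, $G>0$, and let $f_1,\dots,f_T:\mathbb{R}^d\to\mathbb{R}$ be convex and $G$-Lipschitz. Let $f=\frac1T\sum_{t=1}^Tf_t$ and assume $f$ has a minimizer $x_*\in\arg\min f$. Consider the Incremental Proximal Method with step sizes $\eta_1,\dots,\eta_K>0$ (and $\eta_0:=\eta_1$), started at $x_0$, with inexact proximal point evaluations with accuracies $\varepsilon_{k-1,t}>0$ satisfying $$\sum_{t=1}^T\varepsilon_{k-1,t}\le\frac{\eta_k\eta_{k-1}GT}{\sum_{j=k}^K\eta_j}\qquad(1\le k\le K).$$ Then the output $x_K$ satisfies $$f(x_K)-f(x_* )\le\frac{\|x_0-x_*\|^2}{2T\sum_{k=1}^K\eta_k}+\frac{G^2T}{2}\sum_{k=1}^K\frac{\eta_k^2}{\sum_{j=k}^K\eta_j}+\sum_{k=1}^K\sum_{t=1}^T\Big(\frac{\varepsilon_{k-1,t}^2}{2T\sum_{j=k}^K\eta_j}+\frac{3G\varepsilon_{k-1,t}\eta_k}{\sum_{j=k}^K\eta_j}\Big).$$ Moreover, given $\epsilon>0$, if $\sum_{t=1}^T\varepsilon_{k-1,t}\le\frac{2\eta GT}{K-k+1}$ for $1\le k\le K$, then there exists a constant step size $\eta$ such that $f(x_K)-f(x_* )\le\epsilon$ after $TK=\widetilde{\mathcal{O}}\Big(\frac{G^2T\|x_0-x_*\|^2}{\epsilon^2}\Big)$ individual inexact proximal point evaluations.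
   Context: $\|\cdot\|$ is the Euclidean norm on $\mathbb{R}^d$. $g$ is $G$-Lipschitz if $|g(x)-g(y)|\le G\|x-y\|$ for all $x,y$. For convex $g$ and $\eta>0$, $\mathrm{prox}_{\eta g}(x)=\arg\min_{y\in\mathbb{R}^d}\{\frac{1}{2\eta}\|y-x\|^2+g(y)\}$. Incremental Proximal Method (IPM) with inexact proximal point evaluations: given $x_0\in\mathbb{R}^d$, number of epochs $K$, step sizes $\eta_k>0$ and accuracies $\varepsilon_{k-1,t}>0$; for $k=1,\dots,K$ set $x_{k-1,1}=x_{k-1}$, then for $t=1,\dots,T$ let $x_{k-1,t+1}$ be any point with $\|x_{k-1,t+1}-\mathrm{prox}_{\eta_kf_t}(x_{k-1,t})\|\le\varepsilon_{k-1,t}$, and set $x_k=x_{k-1,T+1}$. (Equivalently, with $g_{k-1,t}=\frac{1}{\eta_k}(x_{k-1,t}-x_{k-1,t+1})$ and $M_{\eta_kf_t}$ the Moreau envelope of $f_t$, $\|g_{k-1,t}-\nabla M_{\eta_kf_t}(x_{k-1,t})\|\le\varepsilon_{k-1,t}/\eta_k$.) The output is $x_K$; each epoch uses $T$ individual inexact proximal point evaluations. Convention for the complexity claim: $\widetilde{\mathcal O}(X)$ means at most $C\,X\,(\log(\mathrm{e}+X))^p$ for absolute constants $C,p>0$, and the claim is that there exist an integer $K$ and a step size $\eta$ (with $\eta_k=\eta$ for all $k$, allowed to depend on $K$ and the problem parameters) with $TK=\widetilde{\mathcal O}(X)$ such that $f(x_K)-f(x_* )\le\epsilon$ for every inexact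 run whose accuracies satisfy the stated condition for this $K$ and $\eta$; as usual the bound is read in the regime $X\ge T$ (at least one epoch). *)

(* Defs.v *)
From mathcomp Require Import all_boot all_order all_algebra.
From mathcomp Require Import all_classical all_reals all_analysis.

Set Implicit Arguments.
Unset Strict Implicit.
Unset Printing Implicit Defensive.

Import Order.TTheory GRing.Theory Num.Theory.
Local Open Scope classical_set_scope.
Local Open Scope ring_scope.

(* The canonical norm `|x| on 'rV[R]_d is the sup norm, hence [enorm]. *)
Definition enorm (R : realType) (d : nat) (x : 'rV[R]_d) : R :=
  Num.sqrt (\sum_(i < d) x ord0 i ^+ 2).

Definition elipschitz (R : realType) (d : nat) (G : R) (g : 'rV[R]_d -> R) :=
  forall x y, `|g x - g y| <= G * enorm (x - y).

Definition is_argmin (R : realType) (d : nat) (g : 'rV[R]_d -> R)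
    (p : 'rV[R]_d) :=
  forall y, g p <= g y.

(* For convex real-valued g on R^d and eta > 0 the minimizer exists and is
   unique, so the default value of [xget] is never returned. *)
Definition prox (R : realType) (d : nat) (eta : R) (g : 'rV[R]_d -> R)
    (x : 'rV[R]_d) : 'rV[R]_d :=
  xget 0 [set p | is_argmin (fun y => (2 * eta)^-1 * enorm (y - x) ^+ 2 + g y) p].

(* Components f 1, ..., f T and steps eta 1, ..., eta K are numbered from 1;
   values at other indices are irrelevant. *)
Definition favg (R : realType) (d T : nat) (f : nat -> 'rV[R]_d -> R)
    (x : 'rV[R]_d) : R :=
  T%:R^-1 * \sum_(1 <= t < T.+1) f t x.

(* [x k] is the outer iterate x_k and [z k t] the inner iterate x_{k,t}. *)
Definition ipm_run (R : realType) (d T K : nat) (f : nat -> 'rV[R]_d -> R)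
    (eta : nat -> R) (acc : nat -> nat -> R) (x0 : 'rV[R]_d)
    (x : nat -> 'rV[R]_d) (z : nat -> nat -> 'rV[R]_d) : Prop :=
  x 0%N = x0 /\
  forall k, (1 <= k <= K)%N ->
    [/\ z k.-1 1%N = x k.-1,
        forall t, (1 <= t <= T)%N ->
          enorm (z k.-1 t.+1 - prox (eta k) (f t) (z k.-1 t)) <= acc k.-1 t
      & x k = z k.-1 T.+1].

Definition soft_bigO (R : realType) (C p X : R) : R :=
  C * X * ln (expR 1 + X) `^ p.

(* Main.v *)
(* Put phi = f / G, h_k = G T eta_k, A_k = h_k + ... + h_K and
   eps_k = sum_t acc_{k-1,t}. An exact epoch x |-> p satisfies
     h_k (phi p - phi u) <= |x - u|^2 / 2 - |p - u|^2 / 2 + h_k^2 / 2,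
   and an inexact one is a nonexpansive map at distance at most eps_k from it.
   Going backwards in k, the remaining epochs are compared with a point
   z = (1 - l) x_k + l u; convexity of phi then turns the last-iterate gap at z
   into a gap at u, and l = A_{k+1} / A_k telescopes. This choice leaves
   h_k |x_k - u|^2 / (2 A_k^2) unused, which absorbs by AM-GM the term
   eps_{k+1} |x_k - z| / A_{k+1} created by the accuracy of the next epoch.
   That works while h_k <= 2 A_{k+1}. For h_k > 2 A_{k+1} the next epoch is
   replaced by the exact one at the cost of moving the last iterate by
   eps_{k+1} (nonexpansiveness), and another l pays for it. When
   A_k <= 3 h_k this displacement fits in the term 3 eps_k h_k / A_k.
   For the complexity claim the displacement argument alone suffices: it adds
   sum_k eps_k = O(h log K) to the exact bound for constant steps. *)

Require Import Defs.
From mathcomp Require Import all_boot all_order all_algebra.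
From mathcomp Require Import all_classical all_reals all_analysis.
From mathcomp Require Import ring lra zify.

Set Implicit Arguments.
Unset Strict Implicit.
Unset Printing Implicit Defensive.

Import Order.TTheory GRing.Theory Num.Theory.
Import numFieldNormedType.Exports.
Local Open Scope classical_set_scope.
Local Open Scope ring_scope.

(* The restart point [(1 - l) y + l u] between the iterate and the comparison
   point is chosen adaptively: [l = 0], [l = 1] or the minimizer [g / r ^+ 2].
   This is where the Lipschitz bound [g <= r] beats the usual potential. *)
Lemma restart_weight_unit (R : realFieldType) (rho g r M : R) :
  2 <= rho -> 0 <= r -> g <= r -> rho * g <= M - r ^+ 2 / 2 ->
  rho ^+ 2 / 2 <= M ->
  exists l, [/\ 0 <= l, l <= 1 &
    (1 - l) * g + l ^+ 2 * r ^+ 2 / 2 + rho / 12 <= M / (1 + rho)].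
Proof.
move=> rho2 r0 gr gM rM.
have rho1 : 0 < 1 + rho by lra.
have MM : 3 / 4 * (rho * g + r ^+ 2 / 2) + rho ^+ 2 / 8 <= M by nra.
have [g0|g0] := leP g 0.
  by exists 0; split; rewrite ?ler01// ler_pdivlMr//; nra.
have [rg|gr2] := leP (r ^+ 2) g.
  by exists 1; split; rewrite ?ler01// ler_pdivlMr//; nra.
have r20 : 0 < r ^+ 2 by lra.
have rn0 : r != 0 by apply: contraTneq r20 => ->; rewrite expr0n ltxx.
exists (g / r ^+ 2); split.
- by rewrite divr_ge0// ltW.
- by rewrite ler_pdivrMr// mul1r ltW.
pose w := g ^+ 2 / r ^+ 2.
have w1 : w <= 1.
  by rewrite ler_pdivrMr// mul1r ler_sqr ?nnegrE// ltW.
have w0 : 0 <= w by rewrite divr_ge0// sqr_ge0.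
have -> : (1 - g / r ^+ 2) * g + (g / r ^+ 2) ^+ 2 * r ^+ 2 / 2 = g - w / 2.
  by rewrite /w; field.
(* [r ^+ 2] is bounded below by its tangent at slope [(rho + 4) / 3]. *)
have tangent : 0 <= r ^+ 2 - 2 * ((rho + 4) / 3) * g + ((rho + 4) / 3) ^+ 2 * w.
  have -> : r ^+ 2 - 2 * ((rho + 4) / 3) * g + ((rho + 4) / 3) ^+ 2 * w
     = (r - (rho + 4) / 3 * (g / r)) ^+ 2.
    by rewrite /w; field.
  exact: sqr_ge0.
rewrite ler_pdivlMr//.
have : 0 <= (rho - 2) * ((rho - 2) * (1 - w) + 2).
  have w1' : 0 <= 1 - w by rewrite subr_ge0.
  have rho2' : 0 <= rho - 2 by rewrite subr_ge0.
  by rewrite mulr_ge0// addr_ge0// mulr_ge0.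
lra.
Qed.

Lemma restart_weight (R : realFieldType) (a h g r M : R) :
  0 < a -> 2 * a <= h -> 0 <= r -> g <= r -> h * g <= M - r ^+ 2 / 2 ->
  h ^+ 2 / 2 <= M ->
  exists l, [/\ 0 <= l, l <= 1 &
    (1 - l) * g + (l * r) ^+ 2 / (2 * a) + h / 12 <= M / (a + h)].
Proof.
move=> a0 ah r0 gr gM hM; have an0 : a != 0 by rewrite gt_eqF.
have a20 : 0 < a ^+ 2 by rewrite exprn_gt0.
have [|||||l [l0 l1 H]] := @restart_weight_unit R (h / a) (g / a) (r / a) (M / a ^+ 2).
- by rewrite ler_pdivlMr.
- by rewrite divr_ge0// ltW.
- by rewrite ler_pM2r ?invr_gt0.
- rewrite [leLHS](_ : _ = (h * g) / a ^+ 2); last by field.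
  rewrite [leRHS](_ : _ = (M - r ^+ 2 / 2) / a ^+ 2); last by field.
  by rewrite ler_pM2r ?invr_gt0.
- by rewrite expr_div_n mulrAC ler_pM2r ?invr_gt0.
exists l; split => //.
have ah0 : a + h != 0 by lra.
have := ler_wpM2l (ltW a0) H.
rewrite [leLHS](_ : _ = (1 - l) * g + (l * r) ^+ 2 / (2 * a) + h / 12); last by field.
by rewrite [leRHS](_ : _ = M / (a + h)) //; field; rewrite ?an0 ?ah0.
Qed.

(** * Euclidean inner product, norm and convexity on row vectors *)

Section Euclidean.
Variables (R : realType) (d : nat).
Implicit Types (p q x y u v : 'rV[R]_d) (c l : R).

Definition edot x y : R := \sum_(i < d) x ord0 i * y ord0 i.

Lemma enorm_ge0 x : 0 <= enorm x.
Proof. exact: sqrtr_ge0. Qed.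

Lemma enorm_sqr x : enorm x ^+ 2 = edot x x.
Proof.
rewrite /enorm sqr_sqrtr; first by apply: eq_bigr => i _; rewrite expr2.
by apply: sumr_ge0 => i _; exact: sqr_ge0.
Qed.

Lemma edotC x y : edot x y = edot y x.
Proof. by apply: eq_bigr => i _; rewrite mulrC. Qed.

Lemma edotDl x y u : edot (x + y) u = edot x u + edot y u.
Proof. by rewrite -big_split /=; apply: eq_bigr => i _; rewrite mxE mulrDl. Qed.

Lemma edotZl c x u : edot (c *: x) u = c * edot x u.
Proof. by rewrite mulr_sumr; apply: eq_bigr => i _; rewrite mxE mulrA. Qed.

Lemma edotDr x y u : edot u (x + y) = edot u x + edot u y.
Proof. by rewrite edotC edotDl !(edotC u). Qed.

Lemma edotZr c x u : edot u (c *: x) = c * edot u x.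
Proof. by rewrite edotC edotZl edotC. Qed.

Lemma edotNl x u : edot (- x) u = - edot x u.
Proof. by rewrite -scaleN1r edotZl mulN1r. Qed.

Lemma edotNr x u : edot u (- x) = - edot u x.
Proof. by rewrite edotC edotNl edotC. Qed.

Definition edotE := (edotDl, edotDr, edotNl, edotNr, edotZl, edotZr).

(** Cauchy-Schwarz: the quadratic [|c x - y|^2] in [c] is nonnegative, and [c = |y| / |x|] is the
    value that yields the product of norms. *)
Lemma edot_le x y : edot x y <= enorm x * enorm y.
Proof.
have key c : 0 <= enorm x ^+ 2 * c ^+ 2 - 2 * c * edot x y + enorm y ^+ 2.
  have := sqr_ge0 (enorm (c *: x - y)).
  by rewrite !enorm_sqr !edotE (edotC y x); lra.
have [x0|x0] := eqVneq (enorm x) 0.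
  rewrite x0 mul0r; rewrite leNgt; apply/negP => dgt0.
  (* With [|x| = 0] the quadratic is affine in [c]; this [c] makes it equal to -1. *)
  have := key ((enorm y ^+ 2 + 1) / (2 * edot x y)).
  rewrite x0 [X in 0 <= X](_ : _ = -1) ?ler0N1//.
  by field; rewrite gt_eqF.
have x1 : 0 < enorm x by rewrite lt_neqAle eq_sym x0 enorm_ge0.
have := key (enorm y / enorm x).
rewrite [X in 0 <= X](_ : _ = 2 * (enorm y / enorm x)
   * (enorm x * enorm y - edot x y)); last by field.
have [y0|y0] := eqVneq (enorm y) 0.
  have := key (edot x y / enorm x ^+ 2).
  rewrite y0 [X in 0 <= X](_ : _ = - (edot x y / enorm x) ^+ 2); last by field.
  rewrite oppr_ge0 mulr0 => h _; have : (edot x y / enorm x) ^+ 2 == 0.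
    by rewrite eq_le h sqr_ge0.
  by rewrite sqrf_eq0 mulf_eq0 invr_eq0 (negbTE x0) orbF => /eqP ->.
have y1 : 0 < enorm y by rewrite lt_neqAle eq_sym y0 enorm_ge0.
by rewrite pmulr_rge0 ?subr_ge0// mulr_gt0// divr_gt0.
Qed.

Lemma enorm_triangle x y : enorm (x + y) <= enorm x + enorm y.
Proof.
rewrite -(@ler_pXn2r _ 2)// ?nnegrE ?addr_ge0 ?enorm_ge0//.
rewrite enorm_sqr !edotE sqrrD !enorm_sqr (edotC y x).
by have := edot_le x y; lra.
Qed.

Lemma enormZ c x : enorm (c *: x) = `|c| * enorm x.
Proof.
apply/eqP; rewrite -(@eqrXn2 _ 2)// ?mulr_ge0 ?enorm_ge0//.
by rewrite exprMn !enorm_sqr !edotE real_normK ?num_real// expr2 mulrA.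
Qed.

Lemma enormN x : enorm (- x) = enorm x.
Proof. by rewrite -scaleN1r enormZ normrN1 mul1r. Qed.

Lemma enorm0 : enorm (0 : 'rV[R]_d) = 0.
Proof. by rewrite -(scale0r 0) enormZ normr0 mul0r. Qed.

Lemma enorm_subC x y : enorm (x - y) = enorm (y - x).
Proof. by rewrite -enormN opprB. Qed.

Lemma enorm_subD y x u : enorm (x - u) <= enorm (x - y) + enorm (y - u).
Proof. by rewrite -[x - u](subrKA y) enorm_triangle. Qed.

Lemma enorm_four_point p q x y :
  enorm (x - q) ^+ 2 + enorm (y - p) ^+ 2 - enorm (p - x) ^+ 2
    - enorm (q - y) ^+ 2 = 2 * edot (p - q) (x - y).
Proof.
rewrite !enorm_sqr !edotE (edotC x q) (edotC y p) (edotC x p) (edotC y q).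
by ring.
Qed.

Lemma enorm_sqr_convex x y l :
  enorm ((1 - l) *: x + l *: y) ^+ 2 =
  (1 - l) * enorm x ^+ 2 + l * enorm y ^+ 2 - l * (1 - l) * enorm (y - x) ^+ 2.
Proof. by rewrite !enorm_sqr !edotE (edotC y x); ring. Qed.

Lemma coord_le_enorm x i : `|x ord0 i| <= enorm x.
Proof.
rewrite -(@ler_pXn2r _ 2)// ?nnegrE ?enorm_ge0// enorm_sqr real_normK ?num_real//.
rewrite /edot (bigD1 i)//= -expr2 lerDl; apply: sumr_ge0 => j _.
by rewrite -expr2 sqr_ge0.
Qed.

Lemma continuous_enorm_sub x : continuous (fun y => enorm (y - x)).
Proof.
have sqc i : continuous (fun v : 'rV[R]_d => (v ord0 i - x ord0 i) ^+ 2).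
  move=> /= v; apply: (@continuous_comp _ _ _ (fun v : 'rV[R]_d => v ord0 i - x ord0 i)
    (fun c => c ^+ 2)); last exact: exprn_continuous.
  by apply: continuousB; [exact: coord_continuous|exact: cst_continuous].
move=> y; apply: (@continuous_comp _ _ _ (fun y => \sum_(i < d) (y - x) ord0 i ^+ 2)
  Num.sqrt); last exact: sqrt_continuous.
have -> : (fun y => \sum_(i < d) (y - x) ord0 i ^+ 2)
    = (fun y => \sum_(i <- index_enum 'I_d | true) (y ord0 i - x ord0 i) ^+ 2).
  by apply/funext => v; apply: eq_bigr => i _; rewrite !mxE.
apply: continuous_big => [|i _]; first exact: add_continuous.
exact: sqc.
Qed.

Lemma elipschitz_continuous (G : R) (g : 'rV[R]_d -> R) :
  elipschitz G g -> continuous g.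
Proof.
move=> gG; suff cg (y : 'rV[R]_d) : {for y, continuous g} by move=> y; exact: cg.
have cGn : {for y, continuous (fun v => G * enorm (v - y))}.
  by apply: continuousM; [exact: cst_continuous|exact: continuous_enorm_sub].
have Fy : Filter (nbhs y) := nbhs_filter y.
apply/(@cvgrPdist_le _ _ _ (nbhs y) Fy) => e e0.
move/(@cvgrPdist_le _ _ _ (nbhs y) Fy) : cGn => /(_ e e0).
rewrite subrr enorm0 mulr0.
apply: filterS => v; rewrite sub0r normrN => h.
by rewrite distrC; apply: le_trans (gG v y) (le_trans (ler_norm _) h).
Qed.

Definition econvex (g : 'rV[R]_d -> R) := forall x y l, 0 <= l -> l <= 1 ->
  g ((1 - l) *: x + l *: y) <= (1 - l) * g x + l * g y.

Lemma convex_function_econvex (g : 'rV[R]_d -> R) :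
  convex_function (E := 'rV[R]_d) setT g -> econvex g.
Proof.
move=> cg x y l l0 l1.
have := cg (Itv01 l0 l1) y x (in_setT _) (in_setT _).
by rewrite convRE /= /conv /= [X in g X <= _]addrC [X in _ <= X]addrC.
Qed.

End Euclidean.

(** * Existence, three-point inequality and nonexpansiveness of the proximal map *)

Section Prox.
Variables (R : realType) (d : nat) (G eta : R) (g : 'rV[R]_d -> R).
Hypotheses (eta0 : 0 < eta) (G0 : 0 <= G).
Hypotheses (cvxg : econvex g) (lipg : elipschitz G g).
Implicit Types x y u : 'rV[R]_d.

(** Shows that [xget] never falls back to its default. Once [|y - x|] reaches [2 eta G], the
    quadratic term outweighs any Lipschitz decrease of [g], so the minimizer over a compact box of
    that radius is global. *)
Lemma prox_argmin x :
  is_argmin (fun y => (2 * eta)^-1 * enorm (y - x) ^+ 2 + g y) (prox eta g x).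
Proof.
rewrite /prox; case: xgetP => [_ -> //|none]; exfalso.
set F := fun y => _ in none.
pose rad := 2 * eta * G.
have rad0 : 0 <= rad by rewrite !mulr_ge0// ltW.
pose A := [set v : 'rV[R]_d | forall i,
  `[x ord0 i - rad, x ord0 i + rad]%classic (v ord0 i)].
have cA : compact A.
  apply: (@rV_compact _ _ (fun i => `[x ord0 i - rad, x ord0 i + rad]%classic)).
  by move=> i; exact: segment_compact.
have Ax : A x by move=> i /=; rewrite in_itv /=; apply/andP; split; lra.
have cF : continuous F.
  suff cF (y : 'rV[R]_d) : {for y, continuous F} by move=> y; exact: cF.
  apply: continuousD; last exact: (elipschitz_continuous lipg).
  have csq : {for y, continuous (fun v : 'rV[R]_d => enorm (v - x) ^+ 2)}.
    apply: (@continuous_comp _ _ _ (fun v : 'rV[R]_d => enorm (v - x))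
      (fun c : R => c ^+ 2)); first exact: continuous_enorm_sub.
    exact: exprn_continuous.
  by apply: continuousM; [exact: cst_continuous|exact: csq].
have [|c cA' cmin] := EVT_min_rV (ex_intro _ x Ax) cA (f := F).
  exact: continuous_subspaceT.
apply: (none c) => y /=; have [yA|yA] := pselect (A y).
  by apply: cmin; rewrite inE.
apply: le_trans (cmin x _) _; first by rewrite inE.
rewrite /F subrr enorm0 expr0n mulr0 add0r.
have [i yi] : exists i, ~ `[x ord0 i - rad, x ord0 i + rad]%classic (y ord0 i).
  exact/existsNP.
have rady : rad <= enorm (y - x).
  apply: le_trans (coord_le_enorm _ i); rewrite !mxE; apply: contra_notT yi.
  by rewrite -ltNge ltr_norml /= in_itv /=; lra.
have := lipg x y; rewrite ler_norml => /andP[_ gxy].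
apply: le_trans (_ : g y + G * enorm (y - x) <= _).
  by rewrite addrC -lerBlDr enorm_subC.
rewrite addrC lerD2r expr2 mulrA ler_wpM2r ?enorm_ge0//.
by rewrite [leRHS]mulrC ler_pdivlMr ?mulr_gt0// mulrC.
Qed.

(** Three-point inequality: compare the minimizer [p] with [(1 - l) p + l u], divide by [l] and let
    [l] tend to 0. *)
Lemma prox_strong_argmin x u :
  2 * eta * (g (prox eta g x) - g u) <=
  enorm (x - u) ^+ 2 - enorm (prox eta g x - u) ^+ 2
    - enorm (prox eta g x - x) ^+ 2.
Proof.
set p := prox eta g x; set S := enorm (p - u) ^+ 2.
set c := enorm (x - u) ^+ 2 - enorm (p - x) ^+ 2 - 2 * eta * (g p - g u).
suff : S <= c by rewrite /c; lra.
have key l : 0 < l -> l <= 1 -> (1 - l) * S <= c.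
  move=> l0 l1; have := prox_argmin x ((1 - l) *: p + l *: u).
  rewrite -/p (_ : (1 - l) *: p + l *: u - x
     = (1 - l) *: (p - x) + l *: (u - x)); last first.
    by apply/rowP => i; rewrite !mxE; ring.
  rewrite enorm_sqr_convex (_ : u - x - (p - x) = - (p - u)); last first.
    by apply/rowP => i; rewrite !mxE; ring.
  rewrite enormN -/S => h; have cg := cvxg p u (ltW l0) l1.
  have {}h := le_trans h (lerD (lexx _) cg).
  have e2 : 0 < 2 * eta by rewrite mulr_gt0.
  move: h; rewrite -(ler_pM2l e2) !mulrDr !mulVKf ?gt_eqF// => h.
  by rewrite -(ler_pM2l l0) /c (enorm_subC x u); lra.
rewrite leNgt; apply/negP => cS.
have S0 : 0 <= S by exact: sqr_ge0.
have c0 : 0 <= c by have := key 1 ltr01 (lexx 1); rewrite subrr mul0r.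
have Sp : 0 < S by lra.
(* This weight replaces the limit: it turns [(1 - l) S] into the midpoint of [S] and [c], which
   would exceed [c]. *)
have l0 : 0 < (S - c) / (2 * S) by rewrite divr_gt0; lra.
have l1 : (S - c) / (2 * S) <= 1 by rewrite ler_pdivrMr; lra.
have := key _ l0 l1.
rewrite (_ : (1 - _) * S = (S + c) / 2); last by field; rewrite gt_eqF.
by lra.
Qed.

Lemma prox_dist x : enorm (prox eta g x - x) <= eta * G.
Proof.
have := prox_strong_argmin x x; rewrite subrr enorm0.
set p := prox eta g x; set n := enorm _ => h.
have := lipg x p; rewrite enorm_subC -/n ler_norml => /andP[_ gxp].
have n0 : 0 <= n := enorm_ge0 _.
have [->|nn0] := eqVneq n 0; first by rewrite mulr_ge0// ltW.
have np : 0 < n by rewrite lt_neqAle eq_sym nn0.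
rewrite -(ler_pM2l np); have := ler_wpM2l (ltW eta0) gxp; lra.
Qed.

(** Adding the two three-point inequalities cancels [g] and gives firm nonexpansiveness
    [|p - q|^2 <= <p - q, x - y>]; Cauchy-Schwarz concludes. *)
Lemma prox_nonexpansive x y :
  enorm (prox eta g x - prox eta g y) <= enorm (x - y).
Proof.
have := prox_strong_argmin x (prox eta g y).
have := prox_strong_argmin y (prox eta g x).
move: (prox eta g x) (prox eta g y) => p q; rewrite (enorm_subC q p) => h1 h2.
have h : enorm (p - q) ^+ 2 <= edot (p - q) (x - y).
  by have := enorm_four_point p q x y; lra.
have := le_trans h (edot_le _ _).
have [->|n0] := eqVneq (enorm (p - q)) 0; first by rewrite enorm_ge0.
rewrite expr2 ler_pM2l// lt_neqAle eq_sym n0; exact: enorm_ge0.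
Qed.

End Prox.

(* What a tail run still owes when the step before it had length [hp], the tail
   has total length [b] and starts at distance [s] from the comparison point.
   The first two values are covered by the part [hp * s ^+ 2 / (2 * b ^+ 2)] of
   the distance term that the preceding step leaves unused (half of it is kept
   for the accuracy of the first epoch); the last one by [restart_weight]. *)
Definition pending (R : realFieldType) (hp b s : R) : R :=
  if 2 * hp <= b then hp * s ^+ 2 / (4 * b ^+ 2)
  else if hp <= 2 * b then hp * s ^+ 2 / (2 * b ^+ 2)
  else hp / 12.

(** * Last-iterate bound for abstract exact epochs [P] and inexact epochs [Q], numbered from 1 to
    [N - 1] *)

Section LastIterate.
Variables (R : realType) (d : nat) (phi : 'rV[R]_d -> R) (h eps : nat -> R).
Variables (P Q : nat -> 'rV[R]_d -> 'rV[R]_d) (N : nat).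
Implicit Types (x y u : 'rV[R]_d) (n k : nat).

Hypotheses (cvx : econvex phi) (lip : elipschitz 1 phi).
Hypothesis h_gt0 : forall k, (0 < k < N)%N -> 0 < h k.
Hypothesis eps_ge0 : forall k, (0 < k < N)%N -> 0 <= eps k.
Hypothesis P_descent : forall k x u, (0 < k < N)%N ->
  h k * (phi (P k x) - phi u) <=
  enorm (x - u) ^+ 2 / 2 - enorm (P k x - u) ^+ 2 / 2 + h k ^+ 2 / 2.
Hypothesis Q_close : forall k x, (0 < k < N)%N -> enorm (Q k x - P k x) <= eps k.
Hypothesis Q_nonexpansive : forall k x y, (0 < k < N)%N ->
  enorm (Q k x - Q k y) <= enorm (x - y).

Let A k := \sum_(k <= j < N) h j.
Let cost k := \sum_(k <= j < N) (h j ^+ 2 / (2 * A j) + 3 * eps j * h j / A j).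

Fixpoint tail n k x := if n is m.+1 then tail m k.+1 (Q k x) else x.

Lemma tail_nonexpansive n k x y : (0 < k)%N -> (k + n <= N)%N ->
  enorm (tail n k x - tail n k y) <= enorm (x - y).
Proof.
elim: n k x y => [//|n IHn] k x y k0 kn /=.
by apply: le_trans (IHn _ _ _ _ _) (Q_nonexpansive _ _ _); lia.
Qed.

Lemma phi_le x y : phi x <= phi y + enorm (x - y).
Proof. by rewrite -lerBlDl; apply: le_trans (ler_norm _) _; rewrite -[leRHS]mul1r lip. Qed.

(** Quantified over all [u], because the backward induction replaces the comparison point by a
    restart point. *)
Definition tail_bound (hp : R) n k := forall x u,
  phi (tail n k x) - phi u <=
  enorm (x - u) ^+ 2 / (2 * A k) + pending hp (A k) (enorm (x - u)) + cost k.

Lemma A_rec k : (k < N)%N -> A k = h k + A k.+1.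
Proof. by move=> kN; rewrite /A big_ltn. Qed.

Lemma A_ge0 k : (0 < k)%N -> 0 <= A k.
Proof.
move=> k0; rewrite /A big_nat; apply: sumr_ge0 => j /andP[kj jN].
by apply/ltW/h_gt0; rewrite jN (leq_trans k0 kj).
Qed.

Lemma A_gt0 k : (0 < k < N)%N -> 0 < A k.
Proof. by move=> kN; rewrite A_rec ?ltr_pwDl ?h_gt0 ?A_ge0; lia. Qed.

Lemma cost_rec k : (k < N)%N ->
  cost k = h k ^+ 2 / (2 * A k) + 3 * eps k * h k / A k + cost k.+1.
Proof. by move=> kN; rewrite /cost big_ltn. Qed.

Lemma tail_bound_segment (hp : R) n k y u l : tail_bound hp n k -> 0 <= l -> l <= 1 ->
  phi (tail n k y) - phi u <= (1 - l) * (phi y - phi u)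
    + (l * enorm (y - u)) ^+ 2 / (2 * A k)
    + pending hp (A k) (l * enorm (y - u)) + cost k.
Proof.
move=> tb l0 l1; have := tb y ((1 - l) *: y + l *: u).
have -> : y - ((1 - l) *: y + l *: u) = l *: (y - u).
  by apply/rowP => i; rewrite !mxE; ring.
rewrite enormZ ger0_norm// => tb'; have := cvx y u l0 l1; lra.
Qed.

Section Step.
Variables (n k : nat).
Hypotheses (k0 : (0 < k)%N) (knN : (k + n.+1)%N = N).
(** The guard excludes the empty tail, for which [A k.+1 = 0] would be a denominator. *)
Hypothesis next : (0 < n)%N -> tail_bound (h k) n k.+1.

Let kN : (0 < k < N)%N. Proof. by lia. Qed.
Let hk_gt0 : 0 < h k. Proof. exact: h_gt0. Qed.
Let Ak_gt0 : 0 < A k. Proof. exact: A_gt0. Qed.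
Let Ak_rec : A k = h k + A k.+1. Proof. by rewrite A_rec//; lia. Qed.

(** [M] is the budget of a descent inequality at [y]. A step with [h k <= 2 A k.+1] restarts with
    the fixed weight [A k.+1 / A k]; a longer one uses [restart_weight]. *)
Lemma next_exact y u M :
  h k * (phi y - phi u) <= M - enorm (y - u) ^+ 2 / 2 -> h k ^+ 2 / 2 <= M ->
  phi (tail n k.+1 y) - phi u <= M / A k + cost k.+1.
Proof.
have [[hk0 bk0] Ak] := (hk_gt0, Ak_gt0, Ak_rec).
set g := phi y - phi u; set r := enorm _ => gM hM.
have r0 : 0 <= r := enorm_ge0 _.
have [n0|n0] := posnP n.
  have Nk : N = k.+1 by lia.
  rewrite n0 /= -/g /cost Nk big_geq// addr0 Ak_rec /A Nk big_geq// addr0.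
  by rewrite ler_pdivlMr// mulrC; have := sqr_ge0 r; lra.
have a0 : 0 < A k.+1 by apply: A_gt0; lia.
have bn := next n0; have gr : g <= r by rewrite /g lerBlDl phi_le.
set a := A k.+1 in bn a0 Ak *; set b := A k in bk0 Ak *.
have [ha|ha] := leP (h k) (2 * a).
  have l1 : a / b <= 1 by rewrite ler_pdivrMr// mul1r; lra.
  have l0 : 0 <= a / b by rewrite divr_ge0; lra.
  have := tail_bound_segment y u bn l0 l1; rewrite -/g -/r -/a => H.
  apply: le_trans H _; rewrite lerD2r.
  have pend : pending (h k) a (a / b * r) <= h k * (a / b * r) ^+ 2 / (2 * a ^+ 2).
    rewrite /pending ha; case: ifP => // _; rewrite ler_wpM2l//.
      by rewrite mulr_ge0// ?sqr_ge0// ltW.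
    by rewrite lef_pV2 ?posrE ?mulr_gt0 ?exprn_gt0// ler_wpM2r ?sqr_ge0//; lra.
  apply: le_trans (lerD (lexx _) pend) _.
  (* With [l = a / b] the pending term completes the distance term to exactly [r ^+ 2 / (2 * b)]. *)
  have -> : (1 - a / b) * g + (a / b * r) ^+ 2 / (2 * a)
      + h k * (a / b * r) ^+ 2 / (2 * a ^+ 2) = (h k * g + r ^+ 2 / 2) / b.
    by rewrite Ak; field; rewrite ?gt_eqF//; lra.
  by rewrite ler_pM2r ?invr_gt0//; lra.
have [l [l0 l1 H]] := restart_weight a0 (ltW ha) r0 gr gM hM.
have := tail_bound_segment y u bn l0 l1; rewrite -/g -/r -/a => H'.
apply: le_trans H' _; rewrite lerD2r.
(* Here the pending debt is [h k / 12], the slack provided by [restart_weight]. *)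
rewrite /pending !ifF; [|by apply/negbTE; rewrite -ltNge; lra..].
by apply: le_trans H _; rewrite Ak addrC.
Qed.

Lemma next_short y u : 3 * h k < A k ->
  phi (tail n k.+1 y) - phi u <=
  h k / A k * (phi y - phi u) + enorm (y - u) ^+ 2 / (2 * A k)
    - h k * enorm (y - u) ^+ 2 / (4 * A k ^+ 2) + cost k.+1.
Proof.
move=> hA; have [[hk0 bk0] Ak] := (hk_gt0, Ak_gt0, Ak_rec).
set g := phi y - phi u; set r := enorm _.
have n0 : (0 < n)%N.
  rewrite lt0n; apply/negP => /eqP n0; move: hA; rewrite Ak_rec /A big_geq; last by lia.
  by lra.
have a0 : 0 < A k.+1 by apply: A_gt0; lia.
have bn := next n0.
set a := A k.+1 in bn a0 Ak *; set b := A k in bk0 Ak hA *.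
have l1 : a / b <= 1 by rewrite ler_pdivrMr// mul1r; lra.
have l0 : 0 <= a / b by rewrite divr_ge0; lra.
have := tail_bound_segment y u bn l0 l1; rewrite -/g -/r -/a => H.
apply: le_trans H _; rewrite lerD2r /pending ifT; last by lra.
rewrite le_eqVlt; apply/orP; left; apply/eqP.
by rewrite Ak; field; rewrite ?gt_eqF//; lra.
Qed.

Lemma tail_exact x u :
  phi (tail n k.+1 (P k x)) - phi u <=
  enorm (x - u) ^+ 2 / (2 * A k) + h k ^+ 2 / (2 * A k) + cost k.+1.
Proof.
have [hk0 bk0] := (hk_gt0, Ak_gt0).
have -> : enorm (x - u) ^+ 2 / (2 * A k) + h k ^+ 2 / (2 * A k)
   = (enorm (x - u) ^+ 2 / 2 + h k ^+ 2 / 2) / A k by field; rewrite gt_eqF.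
apply: next_exact; first by have := P_descent x u kN; lra.
by rewrite lerDr divr_ge0// sqr_ge0.
Qed.

(** Only epoch [k] is made exact: the later epochs are nonexpansive and [phi] is 1-Lipschitz, so the
    value changes by at most [eps k]. *)
Lemma tail_displaced x u :
  phi (tail n.+1 k x) - phi u <=
  enorm (x - u) ^+ 2 / (2 * A k) + h k ^+ 2 / (2 * A k) + cost k.+1 + eps k.
Proof.
apply: le_trans (lerD (tail_exact x u) (Q_close x kN)).
rewrite addrAC lerD2r; apply: le_trans (phi_le _ (tail n k.+1 (P k x))) _.
by rewrite lerD2l /= tail_nonexpansive//; lia.
Qed.

(* If [P k x] is already better than [u], comparing with [P k x] itself is
   enough; otherwise the descent inequality bounds its distance to [u] by
   [sqrt (s ^+ 2 + h k ^+ 2)]. *)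
Lemma tail_bound_step (hp : R) : 0 < hp -> eps k <= h k * hp / A k ->
  tail_bound hp n.+1 k.
Proof.
move=> hp0 epsk x u; have [hk0 bk0] := (hk_gt0, Ak_gt0); set s := enorm (x - u); have e0 := eps_ge0 kN.
have kN' : (k < N)%N by case/andP: kN.
rewrite cost_rec//; set b := A k in bk0 epsk *.
have pend0 : 0 <= pending hp b s.
  have hp0' := ltW hp0.
  rewrite /pending; case: ifP => _; last case: ifP => _.
  - by rewrite divr_ge0 ?mulr_ge0 ?enorm_ge0 ?(ltW bk0).
  - by rewrite divr_ge0 ?mulr_ge0 ?enorm_ge0 ?(ltW bk0).
  - by rewrite divr_ge0.
have disp := tail_displaced x u; rewrite -/s -/b in disp.
have epsb : eps k * b <= h k * hp by rewrite -ler_pdivlMr.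
have [hb|hb] := leP b (3 * h k).
  have : eps k <= 3 * eps k * h k / b by rewrite ler_pdivlMr//; nra.
  by lra.
(* After a long preceding step the debt [hp / 12] helps to pay for the displacement: the slack times
   [b ^+ 2] is a product of nonnegative factors plus a multiple of [(b - 6 * h k) ^+ 2]. *)
have [hpb|hpb] := ltP (2 * b) hp.
  rewrite /pending !ifF; [|by apply/negbTE; rewrite -ltNge; lra..].
  suff : eps k <= 3 * eps k * h k / b + hp / 12 by lra.
  rewrite -(ler_pM2r bk0) mulrDl divfK ?gt_eqF// -subr_ge0.
  rewrite -(pmulr_rge0 _ bk0).
  have -> : b * (3 * eps k * h k + hp / 12 * b - eps k * b)
    = (b - 3 * h k) * (h k * hp - eps k * b) + hp / 12 * (b - 6 * h k) ^+ 2 by field.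
  apply: addr_ge0; first by apply: mulr_ge0; lra.
  by apply: mulr_ge0; [lra|exact: sqr_ge0].
rewrite /=; set p := P k x; set y := Q k x.
have yp : enorm (y - p) <= eps k by exact: Q_close.
(* Since [hp <= 2 * b], the accuracy condition gives [eps k <= 2 * h k]. *)
have eps2 : eps k ^+ 2 / (2 * b) <= eps k * h k / b.
  by rewrite -(ler_pM2r bk0) divfK ?gt_eqF// invfM mulrA divfK ?gt_eqF//; nra.
have s0 : 0 <= s ^+ 2 / (2 * b) by rewrite divr_ge0 ?sqr_ge0//; lra.
have hh0 : 0 <= h k ^+ 2 / (2 * b) by rewrite divr_ge0 ?sqr_ge0//; lra.
have short v : phi (tail n k.+1 y) - phi v <=
    h k / b * (phi p - phi v + eps k) + (enorm (p - v) + eps k) ^+ 2 / (2 * b) + cost k.+1.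
  apply: le_trans (next_short y v hb) _; rewrite -/b lerD2r.
  have := phi_le y p => yp'.
  have yv : enorm (y - v) <= enorm (p - v) + eps k.
    by have := enorm_subD p y v; lra.
  have t1 : h k / b * (phi y - phi v) <= h k / b * (phi p - phi v + eps k).
    by apply: ler_wpM2l; [rewrite divr_ge0// ltW|lra].
  have t2 : enorm (y - v) ^+ 2 / (2 * b) <= (enorm (p - v) + eps k) ^+ 2 / (2 * b).
    apply: ler_wpM2r; first by rewrite invr_ge0; lra.
    by rewrite ler_sqr ?nnegrE ?addr_ge0 ?enorm_ge0.
  have t3 : 0 <= h k * enorm (y - v) ^+ 2 / (4 * b ^+ 2).
    by rewrite divr_ge0 ?mulr_ge0 ?enorm_ge0// ltW.
  by lra.
have [pu|pu] := leP (phi p) (phi u).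
  have := short p; rewrite !subrr enorm0 !add0r => F.
  have : h k / b * eps k = eps k * h k / b by rewrite mulrAC (mulrC (h k)).
  have : 0 <= eps k * h k / b by rewrite divr_ge0 ?mulr_ge0// ltW.
  by lra.
have := short u; set rh := enorm (p - u) => F.
have rh0 : 0 <= rh := enorm_ge0 _.
have desc := P_descent x u kN; rewrite -/p -/s -/rh in desc.
have rhs : rh ^+ 2 <= s ^+ 2 + h k ^+ 2.
  have : 0 <= h k * (phi p - phi u) by rewrite mulr_ge0 ?subr_ge0// ltW.
  by lra.
suff : h k / b * (phi p - phi u + eps k) + (rh + eps k) ^+ 2 / (2 * b)
   <= s ^+ 2 / (2 * b) + pending hp b s + h k ^+ 2 / (2 * b) + 3 * eps k * h k / b by lra.
have -> : h k / b * (phi p - phi u + eps k) + (rh + eps k) ^+ 2 / (2 * b)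
   = (h k * (phi p - phi u) + rh ^+ 2 / 2) / b + eps k * h k / b + eps k * rh / b
     + eps k ^+ 2 / (2 * b) by field; rewrite gt_eqF.
have : (h k * (phi p - phi u) + rh ^+ 2 / 2) / b <= s ^+ 2 / (2 * b) + h k ^+ 2 / (2 * b).
  have -> : s ^+ 2 / (2 * b) + h k ^+ 2 / (2 * b) = (s ^+ 2 / 2 + h k ^+ 2 / 2) / b.
    by field; rewrite gt_eqF.
  by rewrite ler_pM2r ?invr_gt0//; lra.
move=> desc'.
(* AM-GM with a free parameter, followed by [rh ^+ 2 <= s ^+ 2 + h k ^+ 2]; [c] is 4 or 2 to match
   the denominators in [pending]. *)
have rhb c : 0 < c -> eps k * rh / b <= eps k * s ^+ 2 / (c * h k * b)
    + (c^-1 + c / 4) * (eps k * h k / b).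
  move=> c0; have e1 : rh <= rh ^+ 2 / (c * h k) + c / 4 * h k.
    rewrite -subr_ge0 (_ : _ - _ = (rh - c / 2 * h k) ^+ 2 / (c * h k)).
      by rewrite divr_ge0 ?sqr_ge0// mulr_ge0// ltW.
    by field; rewrite ?gt_eqF.
  have e2 : rh <= (s ^+ 2 + h k ^+ 2) / (c * h k) + c / 4 * h k.
    apply: le_trans e1 _; rewrite lerD2r ler_pM2r// invr_gt0 mulr_gt0//.
  have -> : eps k * s ^+ 2 / (c * h k * b) + (c^-1 + c / 4) * (eps k * h k / b)
    = eps k / b * ((s ^+ 2 + h k ^+ 2) / (c * h k) + c / 4 * h k).
    by field; rewrite ?gt_eqF.
  by rewrite mulrAC ler_wpM2l// divr_ge0// ltW.
have eps_s c : 0 < c -> eps k * s ^+ 2 / (c * h k * b) <= hp * s ^+ 2 / (c * b ^+ 2).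
  move=> c0; rewrite ler_pdivlMr ?mulr_gt0 ?exprn_gt0//.
  rewrite (_ : _ * (c * b ^+ 2) = eps k * b / h k * s ^+ 2); last by field; rewrite ?gt_eqF.
  by rewrite ler_wpM2r ?sqr_ge0// ler_pdivrMr// [leRHS]mulrC.
rewrite /pending; case: ifPn => [hp2|_].
  (* In units of [eps k * h k / b] the terms cost 1 + 5/4 + 1/4, below 3. *)
  have := rhb 4 (ltr0n _ 4); have := eps_s 4 (ltr0n _ 4).
  have : eps k ^+ 2 / (2 * b) <= eps k * h k / b / 4.
    have eh : eps k <= h k / 2 by rewrite -(ler_pM2r bk0); nra.
    rewrite (_ : _ ^+ 2 / _ = eps k / b * (eps k / 2)); last by field; rewrite gt_eqF.
    rewrite (_ : _ / 4 = eps k / b * (h k / 4)); last by field; rewrite gt_eqF.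
    by apply: ler_wpM2l; [rewrite divr_ge0// ltW|lra].
  by lra.
(* Here they cost 1 + 1 + 1, which exhausts the constant 3. *)
rewrite hpb; have := rhb 2 (ltr0n _ 2); have := eps_s 2 (ltr0n _ 2); lra.
Qed.

(** No earlier step has left anything over, so there is no pending term; the negative term of
    [next_short] at this same epoch absorbs [eps k * r / b] instead. *)
Lemma tail_first x u : eps k <= h k ^+ 2 / A k ->
  phi (tail n.+1 k x) - phi u <= enorm (x - u) ^+ 2 / (2 * A k) + cost k.
Proof.
have [hk0 bk0] := (hk_gt0, Ak_gt0); have e0 := eps_ge0 kN.
have kN' : (k < N)%N by case/andP: kN.
rewrite cost_rec//; set s := enorm (x - u); set b := A k in bk0 *.
rewrite ler_pdivlMr// => epsb.
have disp := tail_displaced x u; rewrite -/s -/b in disp.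
have [hb|hb] := leP b (3 * h k).
  have : eps k <= 3 * eps k * h k / b by rewrite ler_pdivlMr//; nra.
  by lra.
rewrite /=; set p := P k x; set y := Q k x.
have yp : enorm (y - p) <= eps k by exact: Q_close.
have := next_short y u hb; rewrite -/b; set r := enorm (y - u) => F.
have desc := P_descent x u kN; rewrite -/p -/s in desc.
set rh := enorm (p - u) in desc.
have r0 : 0 <= r := enorm_ge0 _; have rh0 : 0 <= rh := enorm_ge0 _.
have rrh : r <= rh + eps k by have := enorm_subD p y u; rewrite -/r -/rh; lra.
have rr : r ^+ 2 / 2 - rh ^+ 2 / 2 <= eps k * r.
  have [re|re] := leP r (eps k).
    by have := ler_wpM2r r0 re; have := sqr_ge0 rh; have := sqr_ge0 r; lra.
  have : (r - eps k) ^+ 2 <= rh ^+ 2 by rewrite ler_sqr ?nnegrE; lra.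
  by have := sqr_ge0 (eps k); lra.
have phiy : phi y <= phi p + eps k by have := phi_le y p; lra.
have {}desc : h k * (phi y - phi u) + r ^+ 2 / 2 <=
   s ^+ 2 / 2 + h k ^+ 2 / 2 + eps k * h k + eps k * r.
  by have := ler_wpM2l (ltW hk0) phiy; lra.
have : (h k * (phi y - phi u) + r ^+ 2 / 2) / b <=
   (s ^+ 2 / 2 + h k ^+ 2 / 2 + eps k * h k + eps k * r) / b.
  by rewrite ler_pM2r ?invr_gt0.
have -> : (h k * (phi y - phi u) + r ^+ 2 / 2) / b =
    h k / b * (phi y - phi u) + r ^+ 2 / (2 * b) by field; rewrite gt_eqF.
have -> : (s ^+ 2 / 2 + h k ^+ 2 / 2 + eps k * h k + eps k * r) / b =
    s ^+ 2 / (2 * b) + h k ^+ 2 / (2 * b) + eps k * h k / b + eps k * r / b.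
  by field; rewrite gt_eqF.
have amgm : eps k * r / b <= h k * r ^+ 2 / (4 * b ^+ 2) + eps k ^+ 2 / h k.
  rewrite -subr_ge0 (_ : _ - _ = (h k * r / (2 * b) - eps k) ^+ 2 / h k).
    by rewrite divr_ge0 ?sqr_ge0// ltW.
  by field; rewrite ?gt_eqF.
have : eps k ^+ 2 / h k <= eps k * h k / b.
  rewrite ler_pdivrMr// mulrAC ler_pdivlMr//; nra.
have : 0 <= eps k * h k / b by rewrite divr_ge0 ?mulr_ge0// ltW.
by lra.
Qed.

End Step.

Lemma tail_bound_all n k : (1 < k)%N -> (k + n.+1)%N = N ->
  (forall j, (1 < j < N)%N -> eps j <= h j * h j.-1 / A j) ->
  tail_bound (h k.-1) n.+1 k.
Proof.
move=> + + epsb; elim: n k => [|n IHn] k k1 kN.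
  apply: tail_bound_step => //; first lia.
    by apply: h_gt0; lia.
  by apply: epsb; lia.
apply: tail_bound_step => //; first lia; first 1 last.
- by apply: h_gt0; lia.
- by apply: epsb; lia.
by move=> _; apply: (IHn k.+1); lia.
Qed.

(** The first epoch goes through [tail_first]; the convention on [h 0] turns its accuracy condition
    into [eps 1 <= h 1 ^+ 2 / A 1]. *)
Theorem last_iterate_bound x u : (1 < N)%N -> h 0%N = h 1%N ->
  (forall j, (0 < j < N)%N -> eps j <= h j * h j.-1 / A j) ->
  phi (tail N.-1 1 x) - phi u <= enorm (x - u) ^+ 2 / (2 * A 1) + cost 1.
Proof.
move=> N1 h01 epsb; have -> : N.-1 = N.-2.+1 by lia.
apply: tail_first => //; [by lia| |].
  move=> N2; have -> : N.-2 = N.-2.-1.+1 by lia.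
  apply: (@tail_bound_all _ 2) => //; first by lia.
  by move=> j jN; apply: epsb; lia.
by have := epsb 1%N; rewrite h01 expr2; apply; lia.
Qed.

End LastIterate.

(** * One epoch of proximal steps, exact or perturbed *)

Section Epoch.
Variables (R : realType) (d T : nat) (G eta : R) (f : nat -> 'rV[R]_d -> R).
Hypotheses (eta0 : 0 < eta) (G0 : 0 <= G).
Hypothesis f_cvx : forall t, (0 < t <= T)%N -> econvex (f t).
Hypothesis f_lip : forall t, (0 < t <= T)%N -> elipschitz G (f t).
Implicit Types (x y u : 'rV[R]_d) (n : nat) (e : nat -> 'rV[R]_d).

(** Errors are fixed translations [e], so an inexact epoch is a map defined at every point, and it
    stays nonexpansive because translations are isometries. The exact epoch has [e = 0]. *)
Fixpoint inner e n x :=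
  if n is m.+1 then prox eta (f m.+1) (inner e m x) + e m.+1 else x.

Lemma inner_nonexpansive e n x y : (n <= T)%N ->
  enorm (inner e n x - inner e n y) <= enorm (x - y).
Proof.
elim: n => [//|n IHn] nT /=; rewrite opprD addrACA subrr addr0.
apply: le_trans (prox_nonexpansive eta0 G0 _ _ _ _) (IHn (ltnW nT)).
- exact: f_cvx.
- exact: f_lip.
Qed.

Lemma inner_close e n x : (n <= T)%N ->
  enorm (inner e n x - inner (fun=> 0) n x) <= \sum_(1 <= t < n.+1) enorm (e t).
Proof.
elim: n => [|n IHn] nT /=; first by rewrite subrr enorm0 big_geq.
rewrite big_nat_recr//= addr0 addrAC.
apply: le_trans (enorm_triangle _ _) _; rewrite lerD2r.
apply: le_trans (prox_nonexpansive eta0 G0 _ _ _ _) (IHn (ltnW nT)).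
- exact: f_cvx.
- exact: f_lip.
Qed.

Lemma inner_run (z : nat -> 'rV[R]_d) n :
  inner (fun t => z t.+1 - prox eta (f t) (z t)) n (z 1%N) = z n.+1.
Proof. by elim: n => [//|n IHn] /=; rewrite IHn addrC subrK. Qed.

Lemma inner_descent n x u : (n <= T)%N ->
  eta * \sum_(1 <= t < n.+1) (f t (inner (fun=> 0) n x) - f t u) <=
  enorm (x - u) ^+ 2 / 2 - enorm (inner (fun=> 0) n x - u) ^+ 2 / 2
  + (eta * G * n%:R) ^+ 2 / 2.
Proof.
elim: n => [|n IHn] nT.
  by rewrite big_geq// !mulr0 expr0n mul0r addr0 subrr.
rewrite big_nat_recr//= addr0; have {IHn} := IHn (ltnW nT).
move: (inner _ n x) => y; have nT' : (0 < n.+1 <= T)%N by [].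
have := prox_strong_argmin eta0 G0 (f_cvx nT') (f_lip nT') y u.
have := prox_dist eta0 G0 (f_cvx nT') (f_lip nT') y.
move: (prox _ _ y) => p py step IH.
(* The earlier components are re-evaluated at the new point, at cost [n] in units of
   [(eta * G) ^+ 2]; the error term grows by [n + 1/2] in these units. *)
have move_le : \sum_(1 <= t < n.+1) (f t p - f t u) <=
    \sum_(1 <= t < n.+1) (f t y - f t u) + n%:R * (G * (eta * G)).
  have -> : n%:R * (G * (eta * G)) = \sum_(1 <= t < n.+1) (G * (eta * G)).
    by rewrite sumr_const_nat subn1 /= mulr_natl.
  rewrite -big_split /= !big_nat; apply: ler_sum => t /andP[t1 tn].
  have tT : (0 < t <= T)%N by rewrite t1 (leq_trans _ nT)// ltnW.
  have := le_trans (ler_norm _) (f_lip tT p y).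
  by have := ler_wpM2l G0 py; lra.
have := ler_wpM2l (ltW eta0) move_le; have := sqr_ge0 (enorm (p - y)).
have := sqr_ge0 (eta * G).
rewrite -(natr1 n); move: IH.
set Sp := \sum_(1 <= t < n.+1) (f t p - f t u).
set Sy := \sum_(1 <= t < n.+1) (f t y - f t u).
move: Sp Sy (n%:R : R) => Sp Sy c. lra.
Qed.

End Epoch.

(** * The normalized average [favg / G] and its epoch descent inequality *)

Section Favg.
Variables (R : realType) (d T : nat) (G : R) (f : nat -> 'rV[R]_d -> R).
Hypotheses (T0 : (0 < T)%N) (G0 : 0 < G).
Hypothesis f_cvx : forall t, (0 < t <= T)%N -> econvex (f t).
Hypothesis f_lip : forall t, (0 < t <= T)%N -> elipschitz G (f t).

Let T_gt0 : 0 < T%:R :> R. Proof. by rewrite ltr0n. Qed.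

Lemma favg_econvex : econvex (fun x => favg T f x / G).
Proof.
move=> x y l l0 l1; rewrite /favg.
have -> : (1 - l) * (T%:R^-1 * (\sum_(1 <= t < T.+1) f t x) / G) +
  l * (T%:R^-1 * (\sum_(1 <= t < T.+1) f t y) / G) =
  T%:R^-1 * (\sum_(1 <= t < T.+1) ((1 - l) * f t x + l * f t y)) / G.
  rewrite big_split -!mulr_sumr /=; ring.
rewrite ler_pM2r ?invr_gt0// ler_pM2l ?invr_gt0// !big_nat.
by apply: ler_sum => t tT; exact: f_cvx.
Qed.

Lemma favg_lipschitz : elipschitz 1 (fun x => favg T f x / G).
Proof.
move=> x y; rewrite mul1r.
have -> : favg T f x / G - favg T f y / G =
    (\sum_(1 <= t < T.+1) (f t x - f t y)) / (G * T%:R).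
  by rewrite /favg sumrB; field; rewrite !gt_eqF.
rewrite normrM [`|_^-1|]gtr0_norm ?invr_gt0 ?mulr_gt0// ler_pdivrMr ?mulr_gt0//.
apply: le_trans (ler_norm_sum _ _ _) _.
have -> : enorm (x - y) * (G * T%:R) = \sum_(1 <= t < T.+1) (G * enorm (x - y)).
  by rewrite sumr_const_nat subn1 /= -mulr_natr; ring.
by rewrite !big_nat; apply: ler_sum => t tT; exact: f_lip.
Qed.

Lemma favg_descent eta x u : 0 < eta ->
  G * T%:R * eta *
    (favg T f (inner eta f (fun=> 0) T x) / G - favg T f u / G) <=
  enorm (x - u) ^+ 2 / 2 - enorm (inner eta f (fun=> 0) T x - u) ^+ 2 / 2
  + (G * T%:R * eta) ^+ 2 / 2.
Proof.
move=> eta0; have := inner_descent eta0 (ltW G0) f_cvx f_lip x u (leqnn T).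
set p := inner _ _ _ _ x; rewrite sumrB.
have -> : G * T%:R * eta * (favg T f p / G - favg T f u / G) =
  eta * (\sum_(1 <= t < T.+1) f t p - \sum_(1 <= t < T.+1) f t u).
  by rewrite /favg; field; rewrite !gt_eqF.
by rewrite (_ : eta * G * T%:R = G * T%:R * eta)//; ring.
Qed.

End Favg.

(** Make the first epoch exact, let the nonexpansive inexact tail carry the displacement, then
    recurse from the exact point. *)
Lemma tails_close (R : realType) (d N : nat) (P Q : nat -> 'rV[R]_d -> 'rV[R]_d)
    (eps : nat -> R) :
  (forall k x, (0 < k < N)%N -> enorm (Q k x - P k x) <= eps k) ->
  (forall k x y, (0 < k < N)%N -> enorm (Q k x - Q k y) <= enorm (x - y)) ->
  forall n k x, (0 < k)%N -> (k + n <= N)%N ->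
  enorm (tail Q n k x - tail P n k x) <= \sum_(k <= j < k + n) eps j.
Proof.
move=> QP Qne; elim=> [|n IHn] k x k0 kn /=.
  by rewrite subrr enorm0 addn0 big_geq.
rewrite big_ltn ?ltnS ?leq_addr//; last by lia.
apply: le_trans (enorm_subD (tail Q n k.+1 (P k x)) _ _) _; apply: lerD.
  apply: le_trans (tail_nonexpansive Qne _ _ _ _) (QP _ _ _); lia.
by rewrite addnS -addSn; apply: IHn; lia.
Qed.

(** * Transfer of the abstract bounds to a run of the method *)

Section Run.
Variables (R : realType) (d T K : nat) (G : R) (f : nat -> 'rV[R]_d -> R).
Variables (x0 : 'rV[R]_d) (eta : nat -> R) (acc : nat -> nat -> R).
Variables (x : nat -> 'rV[R]_d) (z : nat -> nat -> 'rV[R]_d).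
Hypotheses (T0 : (0 < T)%N) (K0 : (0 < K)%N) (G0 : 0 < G).
Hypothesis f_cvx : forall t, (0 < t <= T)%N -> econvex (f t).
Hypothesis f_lip : forall t, (0 < t <= T)%N -> elipschitz G (f t).
Hypothesis eta_gt0 : forall k, (0 < k <= K)%N -> 0 < eta k.
Hypothesis acc_gt0 : forall k t, (0 < k <= K)%N -> (0 < t <= T)%N -> 0 < acc k.-1 t.
Hypothesis run : ipm_run T K f eta acc x0 x z.

Let T_gt0 : 0 < T%:R :> R. Proof. by rewrite ltr0n. Qed.

Let err k t := z k.-1 t.+1 - prox (eta k) (f t) (z k.-1 t).
Let P k := inner (eta k) f (fun=> 0) T.
Let Q k := inner (eta k) f (err k) T.
Let phi y := favg T f y / G.
Let h k := G * T%:R * eta k.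
Let eps k := \sum_(1 <= t < T.+1) acc k.-1 t.

Lemma run_tail : tail Q K 1 x0 = x K.
Proof.
case: run => <- runK.
suff H n k : (0 < k)%N -> (k + n)%N = K.+1 -> tail Q n k (x k.-1) = x K.
  exact: (H K 1%N).
elim: n k => [|n IHn] k k0 kn /=; first by congr (x _); lia.
have kK : (0 < k <= K)%N by lia.
have [z1 _ xk] := runK _ kK.
by rewrite /Q -z1 inner_run -xk; apply: (IHn k.+1); lia.
Qed.

Lemma run_eta_gt0 k : (0 < k < K.+1)%N -> 0 < eta k.
Proof. by move=> kK; apply: eta_gt0; lia. Qed.

Lemma run_h_gt0 k : (0 < k < K.+1)%N -> 0 < h k.
Proof. by move=> kK; rewrite !mulr_gt0// run_eta_gt0. Qed.

Lemma run_eps_ge0 k : (0 < k < K.+1)%N -> 0 <= eps k.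
Proof.
move=> kK; rewrite /eps big_nat; apply: sumr_ge0 => t tT.
by apply/ltW/acc_gt0; lia.
Qed.

Lemma run_descent k y u : (0 < k < K.+1)%N ->
  h k * (phi (P k y) - phi u) <=
  enorm (y - u) ^+ 2 / 2 - enorm (P k y - u) ^+ 2 / 2 + h k ^+ 2 / 2.
Proof. by move=> kK; apply: favg_descent => //; exact: run_eta_gt0. Qed.

Lemma run_close k y : (0 < k < K.+1)%N -> enorm (Q k y - P k y) <= eps k.
Proof.
move=> kK; have kK' : (0 < k <= K)%N by lia.
apply: le_trans (inner_close (run_eta_gt0 kK) (ltW G0) f_cvx f_lip _ _ (leqnn T)) _.
rewrite /eps !big_nat; apply: ler_sum => t tT.
by case: run => _ /(_ k kK')[_ /(_ t) + _]; apply; lia.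
Qed.

Lemma run_nonexpansive (e : nat -> nat -> 'rV[R]_d) k y y' : (0 < k < K.+1)%N ->
  enorm (inner (eta k) f (e k) T y - inner (eta k) f (e k) T y')
    <= enorm (y - y').
Proof.
by move=> kK; exact: (inner_nonexpansive (run_eta_gt0 kK) (ltW G0) f_cvx f_lip).
Qed.

Lemma run_sum_eta_gt0 k : (0 < k < K.+1)%N -> 0 < \sum_(k <= j < K.+1) eta j.
Proof.
move=> /andP[k0 kK]; rewrite big_ltn// ltr_pwDl ?run_eta_gt0 ?k0//.
rewrite big_nat; apply: sumr_ge0 => j jK; apply/ltW/run_eta_gt0; lia.
Qed.

Lemma run_inexact_bound u : eta 0%N = eta 1%N ->
  (forall k, (0 < k <= K)%N -> \sum_(1 <= t < T.+1) acc k.-1 t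
     <= eta k * eta k.-1 * G * T%:R / \sum_(k <= j < K.+1) eta j) ->
  favg T f (x K) - favg T f u
    <= enorm (x0 - u) ^+ 2 / (2 * T%:R * \sum_(1 <= k < K.+1) eta k)
     + G ^+ 2 * T%:R / 2
         * (\sum_(1 <= k < K.+1) (eta k ^+ 2 / \sum_(k <= j < K.+1) eta j))
     + \sum_(1 <= k < K.+1) \sum_(1 <= t < T.+1)
         (acc k.-1 t ^+ 2 / (2 * T%:R * \sum_(k <= j < K.+1) eta j)
          + 3 * G * acc k.-1 t * eta k / \sum_(k <= j < K.+1) eta j).
Proof.
move=> eta01 accb.
have sumh k : \sum_(k <= j < K.+1) h j = G * T%:R * \sum_(k <= j < K.+1) eta j.
  by rewrite mulr_sumr.
have gtn0 a : 0 < a -> (a == 0 :> R) = false by move=> a0; rewrite gt_eqF.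
have := @last_iterate_bound R d phi h eps P Q K.+1 (favg_econvex T0 G0 f_cvx)
  (favg_lipschitz T0 G0 f_lip) run_h_gt0 run_eps_ge0 run_descent run_close
  (run_nonexpansive err) x0 u.
rewrite /= run_tail => /(_ _ _ _)/wrap[].
- by [].
- by rewrite /h eta01.
- move=> k kK; apply: le_trans (accb _ _) _; first by lia.
  rewrite sumh le_eqVlt; apply/orP; left; apply/eqP.
  by rewrite /h; field; rewrite !gtn0// run_sum_eta_gt0.
rewrite -(ler_pM2l G0) /phi -mulrBl mulrC divfK ?gt_eqF// => H.
apply: le_trans H _; rewrite mulrDr -addrA lerD//.
  rewrite sumh le_eqVlt; apply/orP; left; apply/eqP.
  by field; rewrite !gtn0// run_sum_eta_gt0.
rewrite !mulr_sumr -big_split /= !big_nat; apply: ler_sum => k kK.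
have a0 := run_sum_eta_gt0 kK; rewrite sumh.
set a := \sum_(k <= j < K.+1) eta j in a0 *.
have -> : G * (h k ^+ 2 / (2 * (G * T%:R * a)) + 3 * eps k * h k / (G * T%:R * a))
  = G ^+ 2 * T%:R / 2 * (eta k ^+ 2 / a) + 3 * G * eta k / a * eps k.
  by rewrite /h; field; rewrite !gtn0.
rewrite lerD2l mulr_sumr !big_nat; apply: ler_sum => t tT.
have -> : 3 * G * eta k / a * acc k.-1 t = 3 * G * acc k.-1 t * eta k / a.
  by rewrite mulrAC; congr (_ / _); ring.
by rewrite lerDr divr_ge0 ?sqr_ge0// !mulr_ge0// ltW.
Qed.

(* Nonexpansiveness transports the accuracies unamplified to the last iterate. *)
Lemma run_displacement_bound u : eta 0%N = eta 1%N ->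
  (favg T f (x K) - favg T f u) / G
    <= enorm (x0 - u) ^+ 2 / (2 * \sum_(1 <= k < K.+1) h k)
     + \sum_(1 <= k < K.+1) (h k ^+ 2 / (2 * \sum_(k <= j < K.+1) h j))
     + \sum_(1 <= k < K.+1) eps k.
Proof.
move=> eta01.
have := @last_iterate_bound R d phi h (fun=> 0) P P K.+1 (favg_econvex T0 G0 f_cvx)
  (favg_lipschitz T0 G0 f_lip) run_h_gt0 (fun _ _ => lexx 0) run_descent.
move=> /(_ _ (run_nonexpansive (fun=> fun=> 0)) x0 u _ _ _)/wrap[].
- by move=> k y _; rewrite subrr enorm0.
- by [].
- by rewrite /h eta01.
- move=> k kK; have hs : 0 <= \sum_(k <= j < K.+1) h j.
    by rewrite big_nat; apply: sumr_ge0 => j jK; apply/ltW/run_h_gt0; lia.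
  (* Index 0 lies outside the range of positivity, so [h 0] is read as [h 1]. *)
  have [k1|k1] := eqVneq k 1%N.
    rewrite k1 in kK hs *; rewrite /= (_ : h 0%N = h 1%N); last by rewrite /h eta01.
    by rewrite divr_ge0// mulr_ge0// ltW// run_h_gt0.
  by rewrite divr_ge0// mulr_ge0// ltW// run_h_gt0//; lia.
move=> exact_le; have costE : \sum_(1 <= k < K.+1)
    (h k ^+ 2 / (2 * \sum_(k <= j < K.+1) h j)
     + 3 * 0 * h k / \sum_(k <= j < K.+1) h j)
    = \sum_(1 <= k < K.+1) (h k ^+ 2 / (2 * \sum_(k <= j < K.+1) h j)).
  by apply: eq_bigr => k _; rewrite mulr0 !mul0r addr0.
rewrite costE /= in exact_le.
have close := tails_close run_close (run_nonexpansive err) x0 (ltn0Sn 0) (leqnn K.+1).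
rewrite run_tail add1n in close.
have lipx := favg_lipschitz T0 G0 f_lip (x K) (tail P K 1 x0).
have := le_trans (ler_norm _) lipx; rewrite mul1r -/(phi _) -/(phi _) => lipx'.
by rewrite mulrBl -/(phi _) -/(phi _); lra.
Qed.

End Run.

(** * Choice of the number of epochs and of the constant step *)

Section Complexity.
Variable R : realType.

(** After reversing the sum, the induction step is [ln (1 - 1 / (K + 2)) <= - 1 / (K + 2)]. *)
Lemma harmonic_le_ln K : (0 < K)%N ->
  \sum_(1 <= j < K.+1) (K - j + 1)%:R^-1 <= 1 + ln K%:R :> R.
Proof.
move=> K0; rewrite big_nat_rev /= (eq_big_nat _ _ (F2 := fun j => j%:R^-1)); last first.
  by move=> j jK; congr (_%:R^-1); lia.
case: K K0 => [//|K _]; elim: K => [|K IHK].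
  by rewrite big_nat1 invr1 ln1 addr0.
rewrite big_nat_recr//=; apply: le_trans (lerD IHK (lexx _)) _.
rewrite -addrA lerD2l.
have K1 : 0 < K.+1%:R :> R by [].
have K2 : 0 < K.+2%:R :> R by [].
have KE : (K.+2%:R : R) = K.+1%:R + 1 by rewrite natr1.
have := @le_ln1Dx R (- K.+2%:R^-1); rewrite ltrN2 invf_lt1// ltr1n => /(_ isT).
rewrite (_ : 1 + - _ = K.+1%:R / K.+2%:R); last first.
  by rewrite KE; move: K1; move: (K.+1%:R : R) => c c0; field; apply: lt0r_neq0; lra.
rewrite ln_div ?posrE//.
by move: (ln _) (ln _) (_^-1) => a b c; lra.
Qed.

(** Take [K] just above [W = e^16 Y^2 l^2]. Then [ln K <= 17 + 3 l], so the factor of [Y] on the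
    left is at most [53 l], while [sqrt W = e^8 Y l] and [e^8 >= 256]. *)
Lemma soft_epochs (Y : R) : 1 <= Y ->
  exists K : nat, [/\ (0 < K)%N,
    K%:R <= 2 * expR 16 * Y ^+ 2 * ln (expR 1 + Y ^+ 2) ^+ 2 &
    Y * (3 + 5 / 2 * ln K%:R) <= Num.sqrt K%:R].
Proof.
move=> Y1; set l := ln _.
have Y0 : 0 < Y by lra.
have e1 : 2 <= expR 1 :> R by have := expR_ge1Dx (1 : R); lra.
have Y21 : 1 <= Y ^+ 2 by rewrite exprn_ege1.
have l1 : 1 <= l.
  by rewrite -(expRK 1) ler_ln ?posrE ?expR_gt0//; lra.
have l0 : 0 < l by lra.
have e16 : 1 <= expR 16 :> R by have := expR_ge1Dx (16 : R); lra.
set W := expR 16 * Y ^+ 2 * l ^+ 2.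
have W1 : 1 <= W by rewrite /W !mulr_ege1// exprn_ege1.
have W0 : 0 <= W by lra.
have /andP[Kle Kge] := truncn_itv W0.
exists (Num.truncn W).+1; split => //.
  rewrite (_ : _ * _ * _ = 2 * W); last by rewrite /W !mulrA.
  by rewrite -[_.+1%:R]natr1; lra.
set k : R := _.+1%:R in Kge *.
have k0 : 0 < k by lra.
have lnk : ln k <= 17 + 3 * l.
  have k2 : k <= 2 * W by rewrite /k -[_.+1%:R]natr1; lra.
  have : ln k <= ln (2 * W) by rewrite ler_ln ?posrE//; lra.
  have -> : ln (2 * W) = ln 2 + (16 + ln Y *+ 2 + ln l *+ 2).
    by rewrite -!lnXn// -[16](expRK 16) -!lnM ?posrE ?mulr_gt0 ?exprn_gt0 ?expR_gt0//.
  have : ln 2 <= 1 :> R by rewrite -[leRHS](expRK 1) ler_ln ?posrE ?expR_gt0.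
  have := ln_sublinear l0.
  have : ln Y *+ 2 <= l by rewrite -lnXn// ler_ln ?posrE ?exprn_gt0//; lra.
  by rewrite !(mulr2n (ln _)); lra.
have e8 : 256 <= expR 8 :> R.
  rewrite -[8](mulr1 8%:R) expRM_natl; apply: le_trans (_ : 2 ^+ 8 <= _).
    by rewrite -natrX ler_nat.
  by rewrite ler_pXn2r ?nnegrE ?expR_ge0.
apply: le_trans (_ : Num.sqrt W <= _); last by rewrite ler_sqrt; lra.
have -> : Num.sqrt W = expR 8 * Y * l.
  have -> : W = (expR 8 * Y * l) ^+ 2.
    by rewrite !exprMn -expRM_natl; congr (expR _ * _ * _); lra.
  by rewrite sqrtr_sqr ger0_norm// !mulr_ge0 ?expR_ge0// ltW.
rewrite [leRHS](_ : _ = Y * (expR 8 * l)) ?ler_pM2l//; last by ring.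
by have := ler_wpM2r (ltW l0) e8; lra.
Qed.

End Complexity.

(** With [h = G T eta], epoch [k] contributes [h / (2 (K - k + 1))] from the exact bound and
    [2 h / (K - k + 1)] from its accuracy, whence 5/2 times a harmonic sum. *)
Lemma run_constant_step (R : realType) (d T K : nat) (G eta : R)
    (f : nat -> 'rV[R]_d -> R) (x0 u : 'rV[R]_d) (acc : nat -> nat -> R)
    (x : nat -> 'rV[R]_d) (z : nat -> nat -> 'rV[R]_d) :
  (0 < T)%N -> (0 < K)%N -> 0 < G -> 0 < eta ->
  (forall t, (0 < t <= T)%N -> econvex (f t)) ->
  (forall t, (0 < t <= T)%N -> elipschitz G (f t)) ->
  ipm_run T K f (fun=> eta) acc x0 x z ->
  (forall k, (0 < k <= K)%N -> \sum_(1 <= t < T.+1) acc k.-1 t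
     <= 2 * eta * G * T%:R / (K - k + 1)%:R) ->
  (favg T f (x K) - favg T f u) / G <=
  enorm (x0 - u) ^+ 2 / (2 * (G * T%:R * eta) * K%:R)
  + 5 / 2 * (G * T%:R * eta) * (1 + ln K%:R).
Proof.
move=> T0 K0 G0 eta0 f_cvx f_lip run accb.
have := run_displacement_bound T0 K0 G0 f_cvx f_lip (fun _ _ => eta0) run u erefl.
set h := G * T%:R * eta => bound.
have h0 : 0 < h by rewrite !mulr_gt0// ltr0n.
have K_gt0 : 0 < K%:R :> R by rewrite ltr0n.
have sumh k : (0 < k < K.+1)%N -> \sum_(k <= j < K.+1) h = h * (K - k + 1)%:R.
  by move=> kK; rewrite sumr_const_nat mulr_natr; congr (_ *+ _); lia.
pose H : R := \sum_(1 <= j < K.+1) (K - j + 1)%:R^-1.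
apply: le_trans bound _; rewrite -addrA; apply: lerD.
  by rewrite sumh// subn1 addn1 prednK// mulrA.
apply: le_trans (_ : 5 / 2 * h * H <= _); last first.
  by rewrite ler_pM2l ?harmonic_le_ln// mulr_gt0.
rewrite -big_split /H mulr_sumr /= !big_nat; apply: ler_sum => k kK.
have kK' : (0 < k <= K)%N by lia.
have c0 : 0 < (K - k + 1)%:R :> R by rewrite ltr0n addn1.
apply: le_trans (lerD (lexx _) (accb k kK')) _; rewrite sumh//.
move: (_%:R) c0 => c c0.
rewrite le_eqVlt; apply/orP; left; apply/eqP.
rewrite (_ : 2 * eta * G * T%:R = 2 * h); last by rewrite /h; ring.
by field; rewrite !gt_eqF.
Qed.

Theorem corollary3p5 (R : realType) :
  (forall (d T K : nat) (G : R) (f : nat -> 'rV[R]_d -> R)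
      (x0 xstar : 'rV[R]_d) (eta : nat -> R) (acc : nat -> nat -> R)
      (x : nat -> 'rV[R]_d) (z : nat -> nat -> 'rV[R]_d),
    (1 <= T)%N -> (1 <= K)%N -> 0 < G ->
    (forall t, (1 <= t <= T)%N ->
      convex_function (E := 'rV[R]_d) setT (f t) /\ elipschitz G (f t)) ->
    is_argmin (favg T f) xstar ->
    (forall k, (1 <= k <= K)%N -> 0 < eta k) ->
    eta 0%N = eta 1%N ->
    (forall k t, (1 <= k <= K)%N -> (1 <= t <= T)%N -> 0 < acc k.-1 t) ->
    ipm_run T K f eta acc x0 x z ->
    (forall k, (1 <= k <= K)%N ->
      \sum_(1 <= t < T.+1) acc k.-1 t
        <= eta k * eta k.-1 * G * T%:R / \sum_(k <= j < K.+1) eta j) ->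
    favg T f (x K) - favg T f xstar
      <= enorm (x0 - xstar) ^+ 2 / (2 * T%:R * \sum_(1 <= k < K.+1) eta k)
       + G ^+ 2 * T%:R / 2
           * (\sum_(1 <= k < K.+1) (eta k ^+ 2 / \sum_(k <= j < K.+1) eta j))
       + \sum_(1 <= k < K.+1) \sum_(1 <= t < T.+1)
           (acc k.-1 t ^+ 2 / (2 * T%:R * \sum_(k <= j < K.+1) eta j)
            + 3 * G * acc k.-1 t * eta k / \sum_(k <= j < K.+1) eta j))
  /\
  (exists C p : R, [/\ 0 < C, 0 < p &
    forall (d T : nat) (G D epsilon : R),
      (1 <= T)%N -> 0 < G -> 0 <= D -> 0 < epsilon ->
      let X := G ^+ 2 * T%:R * D ^+ 2 / epsilon ^+ 2 in
      T%:R <= X ->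
      exists (K : nat) (eta : R),
        [/\ (1 <= K)%N, 0 < eta, (T * K)%:R <= soft_bigO C p X &
          forall (f : nat -> 'rV[R]_d -> R) (x0 xstar : 'rV[R]_d)
              (acc : nat -> nat -> R)
              (x : nat -> 'rV[R]_d) (z : nat -> nat -> 'rV[R]_d),
            (forall t, (1 <= t <= T)%N ->
              convex_function (E := 'rV[R]_d) setT (f t)
              /\ elipschitz G (f t)) ->
            is_argmin (favg T f) xstar ->
            enorm (x0 - xstar) = D ->
            (forall k t, (1 <= k <= K)%N -> (1 <= t <= T)%N ->
              0 < acc k.-1 t) ->
            ipm_run T K f (fun=> eta) acc x0 x z ->
            (forall k, (1 <= k <= K)%N ->
              \sum_(1 <= t < T.+1) acc k.-1 t
                <= 2 * eta * G * T%:R / (K - k + 1)%:R) ->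
            favg T f (x K) - favg T f xstar <= epsilon]]).
Proof.
split=> [d T K G f x0 xstar eta acc x z T1 K1 G0 fP _ eta0 eta01 acc0 run accb|].
  by apply: (run_inexact_bound T1 K1 G0 _ _ eta0 acc0 run) => // t tT;
    have [/convex_function_econvex] := fP t tT.
exists (2 * expR 16), 2; split=> // d T G D epsilon T1 G0 D0 e0 X TX.
have T0 : 0 < T%:R :> R by rewrite ltr0n.
(* [X = T Y^2], so the regime [T <= X] is [1 <= Y], and [K] of order [Y^2] up to logarithms gives
   the claimed [T K]. *)
pose Y := G * D / epsilon.
have XE : X = T%:R * Y ^+ 2 by rewrite /X /Y; field; rewrite gt_eqF.
have Y0 : 0 <= Y by rewrite divr_ge0 ?mulr_ge0// ltW.
have Y21 : 1 <= Y ^+ 2 by move: TX; rewrite XE ler_pMr.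
have Y1 : 1 <= Y by rewrite -(@ler_pXn2r _ 2) ?nnegrE// expr1n.
have Dpos : 0 < D.
  rewrite lt_neqAle D0 andbT; apply: contraTneq Y1 => D0'.
  by rewrite /Y -D0' mulr0 mul0r -ltNge ltr01.
have [K [K1 Kle Kge]] := soft_epochs Y1.
have sK0 : 0 < Num.sqrt K%:R :> R by rewrite sqrtr_gt0 ltr0n.
have sK2 : Num.sqrt K%:R ^+ 2 = K%:R :> R by rewrite sqr_sqrtr.
(* This makes [h = D / sqrt K], and the two error terms add up to [D / sqrt K] times
   [3 + 5 / 2 * ln K], the factor in [soft_epochs]. *)
pose eta := D / (G * T%:R * Num.sqrt K%:R).
have eta0 : 0 < eta by rewrite divr_gt0// !mulr_gt0.
have etaE : G * T%:R * eta = D / Num.sqrt K%:R.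
  by rewrite /eta; field; rewrite !gt_eqF.
exists K, eta; split=> //.
  have YX : Y ^+ 2 <= X by rewrite XE ler_peMl ?sqr_ge0// ler1n.
  have l0 : 1 <= ln (expR 1 + Y ^+ 2).
    by rewrite -[leLHS](expRK 1) ler_ln ?posrE ?addr_gt0 ?expR_gt0 ?lerDl//; lra.
  have lX : ln (expR 1 + Y ^+ 2) <= ln (expR 1 + X).
    by rewrite ler_ln ?posrE ?addr_gt0 ?expR_gt0 ?lerD2l//; lra.
  rewrite /soft_bigO -[X in _ `^ X]/(2%:R) powR_mulrn; last by lra.
  rewrite natrM; apply: le_trans (ler_wpM2l (ltW T0) Kle) _.
  rewrite [leLHS](_ : _ = 2 * expR 16 * X * ln (expR 1 + Y ^+ 2) ^+ 2).
    apply: ler_wpM2l; first by rewrite mulr_ge0 ?(le_trans (ltW T0) TX).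
    by rewrite ler_sqr ?nnegrE; lra.
  by rewrite XE; ring.
move=> f x0 xstar acc x z fP _ DE _ run accb.
have := run_constant_step xstar T1 K1 G0 eta0 _ _ run accb.
move=> /(_ _ _)/wrap[||gap]; try by move=> t tT;
  have [/convex_function_econvex] := fP t tT.
move: gap; rewrite DE etaE ler_pdivrMr// => /le_trans; apply.
set s := Num.sqrt K%:R in Kge sK0 sK2 *.
move: (ln K%:R) Kge => L Kge; rewrite -sK2.
have -> : (D ^+ 2 / (2 * (D / s) * s ^+ 2) + 5 / 2 * (D / s) * (1 + L)) * G
   = epsilon * (Y * (3 + 5 / 2 * L) / s).
  by rewrite /Y; field; rewrite !gt_eqF.
rewrite -[leRHS]mulr1 ler_pM2l// ler_pdivrMr// mul1r.
exact: le_trans Kge.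
Qed.
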